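(* Let $X_1,X_2$ be finite sets with $|X_i|\ge2$, and for $i=1,2$ let $G_i$ be a group of homeomorphisms of $X_i^\omega$ containing the Higman–Thompson group $\mathcal{V}_{X_i}$. Then every group isomorphism $\phi:G_1\to G_2$ is induced by a homeomorphism $F:X_1^\omega\to X_2^\omega$, i.e., $\phi(g)=F\circ g\circ F^{-1}$ for all $g\in G_1$.
   Context: $X^\omega$ is the space of right-infinite sequences over $X$ with the product topology, $X^*$ the set of finite words. A complete antichain is a finite set $A\subset X^*$ of words, none a prefix of another, with $X^\omega=\bigsqcup_{v\in A}vX^\omega$. The Higman–Thompson group $\mathcal{V}_X$ is the group of homeomorphisms $g$ of $X^\omega$ for which there exist complete antichains $A_1,A_2$ and a bijection $\alpha:A_1\to A_2$ with $g(vw)=\alpha(v)w$ for all $v\in A_1$, $w\in X^\omega$. *)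

(* Defs.v *)
From mathcomp Require Import all_boot.
Set Implicit Arguments. Unset Strict Implicit. Unset Printing Implicit Defensive.

Definition cantor (X : Type) := nat -> X.

(* Continuity for the product topology (X discrete finite): each finite
   initial segment of the output is determined by a finite initial segment
   of the input. *)
Definition continuous (X Y : Type) (f : cantor X -> cantor Y) : Prop :=
  forall (x : cantor X) (n : nat), exists m : nat,
    forall y : cantor X, (forall i, i < m -> y i = x i) ->
      forall i, i < n -> f y i = f x i.

Definition homeo_pair (X Y : Type) (F : cantor X -> cantor Y)
    (Finv : cantor Y -> cantor X) : Prop :=
  [/\ continuous F, continuous Finv, cancel F Finv & cancel Finv F].

Definition homeo (X : Type) (g : cantor X -> cantor X) : Prop :=
  exists h, homeo_pair g h.

Definition prepend (X : Type) (v : seq X) (w : cantor X) : cantor X :=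
  fun n => if n < size v then nth (w 0) v n else w (n - size v).

Definition prefix_inf (X : Type) (v : seq X) (x : cantor X) : Prop :=
  forall i, i < size v -> nth (x 0) v i = x i.

(* A complete antichain, given as a duplicate-free list of words:
   no word is a prefix of another, and the cylinders cover X^omega
   (they are then automatically disjoint). *)
Definition complete_antichain (X : eqType) (A : seq (seq X)) : Prop :=
  [/\ uniq A,
      (forall u v, u \in A -> v \in A -> u != v -> ~~ prefix u v) &
      (forall x : cantor X, exists2 v, v \in A & prefix_inf v x)].

(* Higman--Thompson group V_X: homeomorphisms acting by prefix replacement
   along a bijection alpha : A1 -> A2 (given as A1`_i |-> A2`_i). *)
Definition in_V (X : eqType) (g : cantor X -> cantor X) : Prop :=
  homeo g /\
  exists A1 A2 : seq (seq X),
    [/\ complete_antichain A1, complete_antichain A2, size A1 = size A2 &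
        forall i, i < size A1 -> forall w : cantor X,
          g (prepend (nth [::] A1 i) w) = prepend (nth [::] A2 i) w].

Definition homeo_group (X : Type) (G : (cantor X -> cantor X) -> Prop) : Prop :=
  [/\ forall g, G g -> homeo g,
      G id,
      (forall g h, G g -> G h -> G (g \o h)) &
      (forall g, G g -> exists h, [/\ G h, cancel g h & cancel h g])].

Definition group_iso (X1 X2 : Type)
    (G1 : (cantor X1 -> cantor X1) -> Prop) (G2 : (cantor X2 -> cantor X2) -> Prop)
    (phi : (cantor X1 -> cantor X1) -> (cantor X2 -> cantor X2)) : Prop :=
  [/\ forall g, G1 g -> G2 (phi g),
      (forall g h, G1 g -> G1 h -> phi (g \o h) = phi g \o phi h),
      (forall g h, G1 g -> G1 h -> phi g = phi h -> g = h) &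
      (forall k, G2 k -> exists2 g, G1 g & phi g = k)].

(* Main.v *)
(** The idea is Rubin's: recover supports, and then points, from the group alone.
   Say that [g] is algebraically disjoint from [f] when every [h] not commuting
   with [f] can be turned, by two commutators with elements of the centralizer
   of [g], into a nontrivial element of that centralizer.  Elements with
   disjoint supports are algebraically disjoint, and conversely algebraic
   disjointness makes the support of [g^12] disjoint from that of [f] (12 is a
   common multiple of 1, 2, 3, 4, so that a point moved by [g^12] has at least
   five points in its orbit).  Hence [k] commutes with all such [g^12] exactly
   when [supp k] lies in the closure of [supp f], and this relation is preserved
   by any isomorphism.  Writing [S f] for the interior of the closure of
   [supp f], it follows that "the closure of [supp f] is properly contained in
   [S f']" is also preserved, because it means that conjugation by elements
   supported in [S f'] can shrink [f] into any given nonempty open part of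
   [S f'].  By compactness the sets [S (phi f)], for [f] with [x] in [S f], have
   a common point, and this point is [F x]. *)

Require Import Defs.
From mathcomp Require Import all_boot.
From mathcomp Require Import boolp.

Set Implicit Arguments. Unset Strict Implicit. Unset Printing Implicit Defensive.

(** * Cylinders and prefix swaps *)

Definition agree (X : Type) (n : nat) (x y : cantor X) := forall i, i < n -> y i = x i.

Definition cyl (X : eqType) (u : seq X) (x : cantor X) := mkseq x (size u) == u.

Definition sdrop (X : Type) (n : nat) (x : cantor X) : cantor X := fun i => x (n + i).

Section Words.
Variable X : eqType.
Implicit Types (u v w : seq X) (x y z : cantor X).

Lemma agree_sym n x y : agree n x y -> agree n y x.
Proof. by move=> h i /h ->. Qed.

Lemma agree_trans n x y z : agree n x y -> agree n y z -> agree n x z.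
Proof. by move=> h k i hi; rewrite k ?h. Qed.

Lemma agree_le m n x y : m <= n -> agree n x y -> agree m x y.
Proof. by move=> mn h i hi; apply/h/(leq_trans hi). Qed.

Lemma agree_mkseq n x y : agree n x y <-> mkseq y n = mkseq x n.
Proof.
split=> [h|h i hi]; last by rewrite -(nth_mkseq (x 0) y hi) h nth_mkseq.
apply: (@eq_from_nth _ (x 0)); rewrite !size_mkseq // => i hi.
by rewrite !nth_mkseq ?h.
Qed.

Lemma agree_cyl n x y : agree n x y <-> cyl (mkseq x n) y.
Proof. by rewrite agree_mkseq /cyl size_mkseq; split=> /eqP. Qed.

Lemma agree_neq n x y : x <> y -> exists m, n <= m /\ ~ agree m x y.
Proof.
move=> xy; have [i hi] : exists i, x i <> y i.
  by apply: contrapT => /forallNP h; apply/xy/funext => i; apply: contrapT => /(h i).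
by exists (maxn n i.+1); rewrite leq_maxl; split=> // h; apply/hi/esym/h/leq_maxr.
Qed.

Lemma take_mkseq m n x : m <= n -> take m (mkseq x n) = mkseq x m.
Proof. by move=> mn; rewrite /mkseq -map_take take_iota (minn_idPl mn). Qed.

Lemma cyl_cat u v x : cyl (u ++ v) x = cyl u x && cyl v (sdrop (size u) x).
Proof.
rewrite /cyl size_cat /mkseq iotaD map_cat eqseq_cat ?size_map ?size_iota //=.
rewrite add0n -[in iota (size u) _](addn0 (size u)) iotaDl -map_comp.
by congr andb.
Qed.

Lemma cyl_prefix u v x : prefix u v -> cyl v x -> cyl u x.
Proof. by case/prefixP=> s ->; rewrite cyl_cat => /andP[]. Qed.

Lemma cyl_rcons u a x : cyl (rcons u a) x = cyl u x && (x (size u) == a).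
Proof. by rewrite /cyl size_rcons mkseqS eqseq_rcons. Qed.

Lemma cyl2_prefix u v x : size u <= size v -> cyl u x -> cyl v x -> prefix u v.
Proof. by move=> h /eqP eu /eqP ev; rewrite prefixE -ev take_mkseq ?eu. Qed.

Lemma cyl_agree u x y : cyl u x -> agree (size u) x y -> cyl u y.
Proof. by rewrite /cyl => /eqP <- /agree_mkseq ->; rewrite size_mkseq. Qed.

Lemma sdrop_prepend u y : sdrop (size u) (prepend u y) = y.
Proof.
by apply: funext => i; rewrite /sdrop /prepend ltnNge leq_addr addKn.
Qed.

Lemma cyl_prepend u y : cyl u (prepend u y).
Proof.
apply/eqP/(@eq_from_nth _ (y 0)); rewrite size_mkseq // => i hi.
by rewrite nth_mkseq // /prepend hi.
Qed.

Lemma prepend_sdrop u x : cyl u x -> prepend u (sdrop (size u) x) = x.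
Proof.
move=> /eqP h; apply: funext => i; rewrite /prepend; case: ltnP => hi.
  by rewrite -(nth_mkseq (sdrop (size u) x 0) x hi) h.
by rewrite /sdrop subnKC.
Qed.

Lemma prepend_cat u v y : prepend (u ++ v) y = prepend u (prepend v y).
Proof.
have h : cyl (u ++ v) (prepend u (prepend v y)).
  by rewrite cyl_cat sdrop_prepend !cyl_prepend.
rewrite -(prepend_sdrop h); congr prepend; apply: funext => i.
rewrite /sdrop size_cat -addnA -/(sdrop (size u) (prepend u (prepend v y)) (size v + i)).
by rewrite sdrop_prepend -/(sdrop (size v) (prepend v y) i) sdrop_prepend.
Qed.

Definition incomp u v := ~~ prefix u v && ~~ prefix v u.

Lemma incompC u v : incomp u v = incomp v u.
Proof. exact: andbC. Qed.

Lemma incomp_cyl u v x : incomp u v -> cyl u x -> cyl v x = false.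
Proof.
case/andP=> uv vu hu; apply/negP => hv; case/orP: (leq_total (size u) (size v)) => h.
  by rewrite (cyl2_prefix h hu hv) in uv.
by rewrite (cyl2_prefix h hv hu) in vu.
Qed.

Lemma incomp_rcons u a b : a != b -> incomp (rcons u a) (rcons u b).
Proof.
move=> ab; rewrite /incomp !prefixE !size_rcons.
by rewrite !take_oversize ?size_rcons // !eqseq_rcons !eqxx (eq_sym b) (negPf ab).
Qed.

Lemma incomp_catl u v w : incomp u v -> incomp (u ++ w) v.
Proof.
case/andP=> uv vu; apply/andP; split.
  by apply: contra uv => /catl_prefix.
apply: contra uv => h; have [le|le] := leqP (size v) (size u).
  by move: h vu; rewrite !prefixE takel_cat // => ->.
rewrite !prefixE in h *; rewrite -[X in take _ X](eqP h).
by rewrite take_takel ?take_size_cat // ltnW.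
Qed.

Lemma continuous_comp (Y Z : Type) (f : cantor Y -> cantor Z) (g : cantor X -> cantor Y) :
  continuous f -> continuous g -> continuous (f \o g).
Proof.
move=> cf cg x n; have [m hm] := cf (g x) n; have [p hp] := cg x m.
by exists p => y hy; apply/hm/hp.
Qed.

(** For incomparable words this is an involution. The elements of the Higman-Thompson group used
    below are all such exchanges of two cylinders, or products of two of them. *)
Definition sw u v x : cantor X :=
  if cyl u x then prepend v (sdrop (size u) x)
  else if cyl v x then prepend u (sdrop (size v) x) else x.

Lemma sw_l u v y : sw u v (prepend u y) = prepend v y.
Proof. by rewrite /sw cyl_prepend sdrop_prepend. Qed.

Lemma sw_r u v y : incomp u v -> sw u v (prepend v y) = prepend u y.
Proof.
move=> uv; rewrite /sw cyl_prepend sdrop_prepend.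
by rewrite (incomp_cyl _ (cyl_prepend v y)) // incompC.
Qed.

Lemma sw_out u v x : cyl u x = false -> cyl v x = false -> sw u v x = x.
Proof. by rewrite /sw => -> ->. Qed.

Lemma sw_supp u v x : sw u v x <> x -> cyl u x \/ cyl v x.
Proof.
by rewrite /sw; case: (cyl u x); [left|]; case: (cyl v x) => //; right.
Qed.

Lemma swK u v : incomp u v -> involutive (sw u v).
Proof.
move=> uv x; case hu: (cyl u x).
  by rewrite -(prepend_sdrop hu) sw_l sw_r.
case hv: (cyl v x); last by rewrite !sw_out.
by rewrite -(prepend_sdrop hv) sw_r // sw_l.
Qed.

Lemma prepend_agree u n x y : agree n x y -> agree (size u + n) (prepend u x) (prepend u y).
Proof.
move=> h i hi; rewrite /prepend; case: ltnP => hu; last first.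
  by apply: h; rewrite ltn_subLR.
exact: set_nth_default.
Qed.

Lemma sdrop_agree m n x y : agree (m + n) x y -> agree n (sdrop m x) (sdrop m y).
Proof. by move=> h i hi; apply: h; rewrite ltn_add2l. Qed.

Lemma sw_continuous u v : continuous (sw u v).
Proof.
move=> x n; exists (size u + size v + n) => y hy.
have hu : cyl u y = cyl u x.
  by apply/idP/idP => /cyl_agree; apply; [apply: agree_sym|]; apply: agree_le hy;
    rewrite -addnA leq_addr.
have hv : cyl v y = cyl v x.
  by apply/idP/idP => /cyl_agree; apply; [apply: agree_sym|]; apply: agree_le hy;
    rewrite -addnA addnCA leq_addr.
have hn : agree n x y by apply: agree_le hy; rewrite leq_addl.
rewrite /sw hu hv; case: ifP => _; last (case: ifP => _ //).
  apply: (agree_le (leq_addl (size v) n)); apply: prepend_agree; apply: sdrop_agree.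
  by apply: agree_le hy; rewrite leq_add2r leq_addr.
apply: (agree_le (leq_addl (size u) n)); apply: prepend_agree; apply: sdrop_agree.
by apply: agree_le hy; rewrite leq_add2r leq_addl.
Qed.

End Words.

(** The antichain is completed by the words of length [n], the larger of the two lengths, that
    extend neither [u] nor [v]. By their length, none of these is a proper prefix of [u] or [v]. *)
Lemma complete_antichain_incomp (X : finType) (u v : seq X) : incomp u v ->
  exists s, (forall w, w \in s -> incomp w u /\ incomp w v) /\
    complete_antichain [:: u, v & s].
Proof.
move=> uv; set n := maxn (size u) (size v).
pose s := [seq w <- map val (enum {: n.-tuple X}) | ~~ prefix u w && ~~ prefix v w].
have sP w : w \in s -> size w = n /\ incomp w u /\ incomp w v.
  rewrite mem_filter => /andP[/andP[uw vw] /mapP[t _ wt]].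
  have sw : size w = n by rewrite wt size_tuple.
  split=> //; rewrite /incomp uw vw !andbT; split.
    apply/negP => h; move: (size_prefix h); rewrite sw => hs.
    move: uw; rewrite -(eqP (_ : w == u)) ?prefix_refl //.
    by move: h; rewrite prefixE take_oversize ?sw ?(leq_trans _ hs) ?leq_maxl // eq_sym.
  apply/negP => h; move: (size_prefix h); rewrite sw => hs.
  move: vw; rewrite -(eqP (_ : w == v)) ?prefix_refl //.
  by move: h; rewrite prefixE take_oversize ?sw ?(leq_trans _ hs) ?leq_maxr // eq_sym.
have inc w : w \in s -> incomp w u /\ incomp w v by case/sP.
have nn w : ~~ @incomp X w w by rewrite /incomp prefix_refl.
exists s; split=> //; split.
- rewrite /= inE negb_or filter_uniq ?(map_inj_uniq val_inj) ?enum_uniq ?andbT //.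
  rewrite (_ : u != v) /=; last by apply: contraTneq uv => ->.
  by apply/andP; split; apply/negP => /inc[h h']; [move: (nn u)|move: (nn v)];
    rewrite ?h ?h'.
- move=> w1 w2; rewrite !inE.
  have inc1 w z : incomp w z -> ~~ prefix w z by case/andP.
  have inc2 w z : incomp w z -> ~~ prefix z w by case/andP.
  case/or3P=> [/eqP->|/eqP->|h1]; case/or3P=> [/eqP->|/eqP->|h2]; rewrite ?eqxx // => ne;
    try (by apply: inc1); try (by apply: inc2);
    try (by have [/inc2 ? /inc2 ?] := inc _ h2); try (by have [/inc1 ? /inc1 ?] := inc _ h1).
  have [s1 _] := sP _ h1; have [s2 _] := sP _ h2.
  by rewrite prefixE take_oversize ?s1 ?s2 // eq_sym.
- move=> x; have pc w : cyl w x -> prefix_inf w x.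
    by move=> /eqP h i hi; rewrite -{1}h nth_mkseq.
  case hu: (cyl u x); first by exists u; rewrite ?mem_head //; exact: pc.
  case hv: (cyl v x); first by exists v; rewrite ?inE ?eqxx ?orbT //; exact: pc.
  have cx : cyl (mkseq x n) x by apply/agree_cyl.
  exists (mkseq x n); last exact: pc.
  rewrite !inE mem_filter -andbA; apply/orP; right; apply/orP; right; apply/and3P; split.
  - by apply/negP => h; rewrite (cyl_prefix h) in hu.
  - by apply/negP => h; rewrite (cyl_prefix h) in hv.
  - apply/mapP; exists (Tuple (introT eqP (size_mkseq x n))) => //.
    by rewrite mem_enum.
Qed.

Lemma sw_in_V (X : finType) (u v : seq X) : incomp u v -> in_V (sw u v).
Proof.
move=> uv; split.
  by exists (sw u v); split; rewrite ?swK //; try exact: sw_continuous; exact: swK.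
have [s [sP ca]] := complete_antichain_incomp uv.
exists [:: u, v & s], [:: v, u & s]; split=> //.
- case: ca => h1 h2 h3; split.
  - by move: h1; rewrite /= !inE !negb_or (eq_sym v) => /and3P[/andP[-> ->] -> ->].
  - have e w : (w \in [:: v, u & s]) = (w \in [:: u, v & s]) by rewrite !inE orbCA.
    by move=> w1 w2; rewrite !e; exact: h2.
  - by move=> x; have [w hw ?] := h3 x; exists w => //; move: hw; rewrite !inE orbCA.
- move=> [|[|i]] /= hi w; rewrite ?sw_l ?sw_r //.
  have /sP[h1 h2] : nth [::] s i \in s by exact: mem_nth.
  by rewrite sw_out // (incomp_cyl _ (cyl_prepend _ w)).
Qed.

(** * Supports and algebraic disjointness *)

Section Supports.
Variable X : Type.
Implicit Types (f g h k : cantor X -> cantor X) (x y z : cantor X).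

(** Choosing the inverse classically makes inversion an operation on all functions, so that
    commutators are plain compositions. A function without a two-sided inverse is sent to itself. *)
Definition cinv f : cantor X -> cantor X :=
  if pselect (exists h, cancel f h /\ cancel h f) is left e then projT1 (cid e) else f.

Lemma cinv_cancel f h : cancel f h -> cancel h f -> cancel f (cinv f) /\ cancel (cinv f) f.
Proof.
move=> fh hf; rewrite /cinv; case: pselect => [e|[]]; last by exists h.
by case: (cid e).
Qed.

Lemma cinv_eq f h : cancel f h -> cancel h f -> cinv f = h.
Proof.
move=> fh hf; have [_ vf] := cinv_cancel fh hf.
by apply: funext => x; rewrite -[LHS]fh vf.
Qed.

Definition commutes f g := f \o g = g \o f.

Definition commutator f g := f \o g \o cinv f \o cinv g.

Lemma commutesP f g : commutes f g <-> forall x, f (g x) = g (f x).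
Proof. by split=> [h x|h]; [exact: (congr1 (@^~ x) h) | apply: funext => x; exact: h]. Qed.

Lemma commutes_inv f h g : cancel f h -> cancel h f -> commutes f g -> commutes h g.
Proof. by move=> fh hf /commutesP c; apply/commutesP => x; rewrite -{1}(hf x) -c fh. Qed.

Definition supp_cl f x := forall n, exists y, agree n x y /\ f y <> y.

(** With [supp_cl f] the closure of the support, this is the regular open set [S f]. *)
Definition supp_int f x := exists n, forall y, agree n x y -> supp_cl f y.

Definition supp_le k f := forall x, k x <> x -> supp_cl f x.

Definition alg_disjoint (G : (cantor X -> cantor X) -> Prop) f g :=
  forall h, G h -> ~ commutes f h -> exists f1 f2,
    [/\ G f1, G f2, commutes f1 g, commutes f2 g &
      commutator f1 (commutator f2 h) <> id /\
      commutes (commutator f1 (commutator f2 h)) g].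

Definition alg_supp_le (G : (cantor X -> cantor X) -> Prop) k f :=
  forall g, G g -> alg_disjoint G f g -> commutes k (iter 12 g).

Lemma neq_id f : f <> id -> exists x, f x <> x.
Proof.
move=> h; apply: contrapT => /forallNP k; apply/h/funext => x.
by apply: contrapT => /(k x).
Qed.

(** By injectivity each map preserves its own support, and the other map is the identity there. *)
Lemma commutes_disjoint f g : injective f -> injective g ->
  (forall x, f x = x \/ g x = x) -> commutes f g.
Proof.
move=> fi gi d; apply/commutesP => x.
have [fx|nfx] := pselect (f x = x).
  rewrite fx; have [//|/gi gx] := d (g x).
  by rewrite gx fx.
have [//|gx] := d x; rewrite gx.
by have [/fi|] := d (f x).
Qed.

Lemma iter_fixed f x m n : iter m f x = x -> iter (n * m) f x = x.
Proof. by move=> h; elim: n => // n IH; rewrite mulSn iterD IH. Qed.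

Lemma commutes_iter f g n : commutes f g -> commutes f (iter n g).
Proof.
move=> /commutesP c; apply/commutesP => x.
by elim: n => //= n IH; rewrite c IH.
Qed.

Lemma injective_iter f n : injective f -> injective (iter n f).
Proof. by move=> fi; elim: n => // n IH x y /= /fi/IH. Qed.

End Supports.

Lemma continuous_iter (X : eqType) (f : cantor X -> cantor X) n :
  continuous f -> continuous (iter n f).
Proof.
move=> cf; elim: n => [|n IH]; first by move=> x m; exists m.
exact: continuous_comp cf IH.
Qed.

(** If [p] changes letter [i] of [x], continuity gives all nearby points that same wrong letter [i].
    Hence every deep enough cylinder around [x] is disjoint from its image. *)
Lemma move_off (X : eqType) (p : cantor X -> cantor X) x : continuous p -> p x <> x ->
  exists n, forall m, n <= m -> forall y, agree m x y -> ~ agree m x (p y).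
Proof.
move=> cp px; have [i hi] : exists i, p x i <> x i.
  by apply: contrapT => /forallNP h; apply/px/funext => i; apply: contrapT => /(h i).
have [m0 h0] := cp x i.+1.
exists (maxn m0 i.+1) => m; rewrite geq_max => /andP[m0m im] y xy yp.
by apply: hi; rewrite -(h0 _ (agree_le m0m xy) i) // (yp i).
Qed.

Lemma two_letters (X : finType) (hX : 1 < #|X|) : exists a b : X, a != b.
Proof. by have [a [b [_ _ ?]]] := card_gt1P hX; exists a, b. Qed.

(** The product [f2 \o f1] takes the prefix [wa] to [wb] and then to [waa], so it has infinite
    order. This serves twice: its 12th power is nontrivial, and [f1], [f2] do not commute, since a
    product of commuting involutions has trivial square. *)
Lemma local_swaps (X : finType) (hX : 1 < #|X|) (w : seq X) :
  exists f1 f2 : cantor X -> cantor X,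
  [/\ in_V f1 /\ in_V f2, involutive f1 /\ involutive f2,
      (forall z, ~~ cyl w z -> f1 z = z) /\ (forall z, ~~ cyl w z -> f2 z = z) &
      exists z, iter 12 (f2 \o f1) z <> z].
Proof.
have [a [b ab]] := two_letters hX.
set wa := rcons w a; set wb := rcons w b; set waa := rcons wa a.
have i1 : incomp wa wb by exact: incomp_rcons.
have i2 : incomp waa wb by rewrite /waa -cats1; exact: incomp_catl.
have cw u c z : cyl (rcons u c) z -> cyl u z by apply/cyl_prefix/prefix_rcons.
have no z u v : (cyl u z -> cyl w z) -> (cyl v z -> cyl w z) ->
    ~~ cyl w z -> sw u v z = z.
  by move=> uw vw nz; apply: sw_out; apply/negP; [move/uw|move/vw]; exact/negP.
exists (sw wa wb), (sw waa wb); split.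
- by split; exact: sw_in_V.
- by split; exact: swK.
- by split=> z; apply: no => // /cw; do ?move/cw.
set g := _ \o _.
have gE y : g (prepend wa y) = prepend (rcons wa a) y.
  by rewrite /g /= sw_l sw_r.
have gn n y : iter n g (prepend wa y) = prepend wa (prepend (nseq n a) y).
  elim: n y => [|n IH] y /=.
    by congr prepend; apply: funext => i; rewrite /prepend subn0.
  by rewrite IH gE -(cats1 wa) -(cat1s a (nseq n a)) !prepend_cat.
(* The 12th power inserts twelve letters [a] after [wa], where this point has [b]. *)
exists (prepend wa (fun=> b)); rewrite gn => h.
have := congr1 (sdrop (size wa)) h; rewrite !sdrop_prepend => /(congr1 (@^~ 0)).
by rewrite /prepend /= => /eqP; apply/negP.
Qed.

(** * Recovering inclusion of supports from the group *)

Section Reconstruction.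
Variables (X : finType) (G : (cantor X -> cantor X) -> Prop).
Hypotheses (hX : 1 < #|X|) (hG : homeo_group G) (hV : forall g, in_V g -> G g).
Implicit Types (f g h k : cantor X -> cantor X) (x y z : cantor X).

Lemma group_continuous g : G g -> continuous g.
Proof. by case: hG => hh _ _ _ /hh[h []]. Qed.

Lemma group_inv g : G g -> [/\ G (cinv g), cancel g (cinv g) & cancel (cinv g) g].
Proof.
case: hG => _ _ _ hi /hi[h [Gh gh hg]]; have [] := cinv_cancel gh hg.
by rewrite (cinv_eq gh hg).
Qed.

Lemma group_inj g : G g -> injective g.
Proof. by move=> /group_inv[_ /can_inj]. Qed.

Lemma group_comp f g : G f -> G g -> G (f \o g).
Proof. by case: hG => _ _ h _; exact: h. Qed.

Lemma group_comm f g : G f -> G g -> G (commutator f g).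
Proof.
move=> Gf Gg; have [Gf' _ _] := group_inv Gf; have [Gg' _ _] := group_inv Gg.
exact: (group_comp (group_comp (group_comp Gf Gg) Gf') Gg').
Qed.

Lemma group_iter n g : G g -> G (iter n g).
Proof.
move=> Gg; elim: n => [|n IH]; first by case: hG.
exact: (group_comp Gg IH).
Qed.

(** Near a point moved by both [f] and [h] there is a cylinder [U] inside the support of [f] and
    disjoint from its image under [h]. For [f1], [f2] supported in [U], the commutator [[f2, h]]
    acts on [U] as [f2], so [[f1, [f2, h]]] is [[f1, f2]] on [U] and trivial elsewhere. Everything
    supported in [U] commutes with [g]. *)
Lemma alg_disjoint_of_disjoint f g : G f -> G g ->
  (forall x, f x = x \/ g x = x) -> alg_disjoint G f g.
Proof.
move=> Gf Gg fg h Gh nc; have [_ hK Kh] := group_inv Gh.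
have [x [fx hx]] : exists x, f x <> x /\ h x <> x.
  apply: contrapT => /forallNP n; apply/nc/commutes_disjoint; try exact: group_inj.
  by move=> x; apply: contrapT => /not_orP[? ?]; apply: (n x).
have [n1 m1] := move_off (group_continuous Gf) fx.
have [n2 m2] := move_off (group_continuous Gh) hx.
set n := maxn n1 n2; set w := mkseq x n; set U := cyl w.
have Uf y : U y -> f y <> y.
  move=> /agree_cyl xy fy; apply: (m1 n _ y xy); first exact: leq_maxl.
  by rewrite fy.
have Uh y : U y -> ~~ U (h y).
  move=> /agree_cyl xy; apply/negP => /agree_cyl; apply: m2 xy; exact: leq_maxr.
have [f1 [f2 [[V1 V2] [I1 I2] [S1 S2] [z0 hz0]]]] := local_swaps hX w.
have [G1 G2] := (hV V1, hV V2).
have keep p : involutive p -> (forall y, ~~ U y -> p y = y) -> forall y, U y -> U (p y).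
  move=> pK pS y Uy; apply: contraT => Npy.
  by move: (Npy); rewrite -{1}(pS _ Npy) pK Uy.
have [_ k1 k2] := group_inv (group_comm G2 Gh).
set k := commutator f2 h in k1 k2 *.
(* For [y] in [U] the point [cinv h y] is outside [U], where [f2] is trivial. *)
have kU y : U y -> k y = f2 y.
  move=> Uy; rewrite /k /commutator /= (cinv_eq I2 I2) (S2 (cinv h y)) ?Kh //.
  by apply/negP => /Uh; rewrite Kh Uy.
have cU y : ~~ U y -> commutator f1 k y = y.
  move=> Uy; rewrite /commutator /= (cinv_eq I1 I1) (S1 (cinv k y)) ?k2 ?S1 //.
  apply/negP => Uk; have := keep _ I2 S2 _ Uk; rewrite -kU // k2.
  exact/negP.
have cg p : G p -> (forall y, ~~ U y -> p y = y) -> commutes p g.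
  move=> Gp pS; apply: commutes_disjoint; try exact: group_inj.
  move=> y; case Uy: (U y); last by left; apply: pS; rewrite Uy.
  by right; have [/(Uf _ Uy)|] := fg y.
exists f1, f2; split; try exact: cg; try by [].
split; last exact: cg (group_comm G1 (group_comm G2 Gh)) cU.
(* If the double commutator were trivial, [f1] and [f2] would commute, [f2 \o f1] would have trivial
   square, and so would its 12th power be trivial. *)
move=> c1; apply: hz0.
have e y : f1 (f2 y) = f2 (f1 y).
  have [Uy|Uy] := boolP (U y); last by rewrite (S2 y) // (S1 y) // S2.
  have : commutator f1 k (k (f1 y)) = k (f1 y) by rewrite /k c1.
  rewrite /commutator /= k1 (cinv_eq I1 I1) I1 kU // => ->.
  by rewrite kU // keep.
have g2 y : (f2 \o f1) ((f2 \o f1) y) = y by rewrite /= -e I2 I1.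
exact: (@iter_fixed _ (f2 \o f1) z0 2 6 (g2 z0)).
Qed.

(* A nontrivial point of [c = [f1,[f2,h]]] has its [g]-orbit in the support of
   [c], which is covered by the four translates of [U] by [1], [f2], [f1] and
   [f1 f2]; each translate is disjoint from its images under [g, ..., g^4], so
   among five points of the orbit two would lie in the same translate. *)
Lemma disjoint_of_alg_disjoint f g x : G f -> G g -> alg_disjoint G f g ->
  iter 12 g x <> x -> f x = x.
Proof.
move=> Gf Gg fg g12; apply: contrapT => fx.
have gi i : 0 < i <= 4 -> iter i g x <> x.
  move=> hi h; apply: g12; have /dvdnP[q ->] : i %| 12.
    by case: i hi {h} => [|[|[|[|[|]]]]].
  exact: iter_fixed.
have [n1 m1] := move_off (group_continuous Gf) fx.
have [n2 m2] : exists n, forall m, n <= m -> forall i, 0 < i <= 4 ->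
    forall y, agree m x y -> ~ agree m x (iter i g y).
  have /fin_all_exists[n hn] : forall i : 'I_5, exists n, forall m, n <= m -> 0 < i ->
      forall y, agree m x y -> ~ agree m x (iter i g y).
    move=> i; have [i0|i0] := posnP i; first by exists 0; rewrite i0.
    have := gi i; rewrite i0 -ltnS ltn_ord => /(_ isT) gx.
    have [n hn] := move_off (continuous_iter i (group_continuous Gg)) gx.
    by exists n => m nm _; exact: hn.
  exists (\max_i n i) => m nm i /andP[i0 i4]; rewrite -ltnS in i4.
  apply: (hn (Ordinal i4)) => //; apply: leq_trans nm; exact: leq_bigmax.
set n := maxn n1 n2; set w := mkseq x n; set U := cyl w.
have Uf y : U y -> ~~ U (f y).
  move=> /agree_cyl xy; apply/negP => /agree_cyl; apply: m1 xy; exact: leq_maxl.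
have Ug i y : 0 < i <= 4 -> U y -> ~~ U (iter i g y).
  move=> hi /agree_cyl xy; apply/negP => /agree_cyl; apply: m2 hi _ xy; exact: leq_maxr.
have [h [Gh hS [z0 hz0]]] : exists h, [/\ G h, forall y, ~~ U y -> h y = y &
    exists z, h z <> z].
  have [p1 [p2 [[V1 V2] [I1 I2] [S1 S2] [z hz]]]] := local_swaps hX w.
  exists (p2 \o p1); split.
  - by apply: group_comp; exact: hV.
  - by move=> y Uy; rewrite /= S1 ?S2.
  - by exists z => hz'; apply: hz; exact: (@iter_fixed _ _ z 1 12).
have Uz0 : U z0 by apply: contraT => /hS /hz0.
(* [h] does not commute with [f]: it moves [z0] but fixes [f z0], which lies outside [U]. *)
have [] := fg h Gh.
  move=> /commutesP/(_ z0); rewrite (hS (f z0)) ?Uf //.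
  by move/(group_inj Gf)/hz0.
move=> f1 [f2 [G1 G2 c1 c2 [c_neq c_g]]].
have [_ fK1 Kf1] := group_inv G1; have [_ fK2 Kf2] := group_inv G2.
have [_ hK Kh] := group_inv Gh.
have [_ kK Kk] := group_inv (group_comm G2 Gh).
have hS' y : ~~ U y -> cinv h y = y by move=> Uy; rewrite -{1}(hS y Uy) hK.
have kS y : ~~ U y -> ~~ U (cinv f2 y) -> commutator f2 h y = y.
  by move=> u1 u2; rewrite /commutator /= hS' // hS // Kf2.
(* [U (E b y)] says that [y] lies in one of the four translates of [U]; the bits of [b] tell whether
   [f1] and [f2] enter the translation. *)
pose E (b : bool * bool) y :=
  (if b.2 then cinv f2 else id) ((if b.1 then cinv f1 else id) y).
have cS y : commutator f1 (commutator f2 h) y <> y -> exists b, U (E b y).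
  move=> cy; apply: contrapT => /forallNP no; apply: cy.
  have nE b : ~~ U (E b y) by apply/negP/no.
  have k' : cinv (commutator f2 h) y = y.
    by rewrite -{1}(kS y (nE (false, false)) (nE (false, true))) kK.
  rewrite {1}/commutator /= k' (kS _ (nE (true, false)) (nE (true, true))).
  exact: Kf1.
have Eg b i y : E b (iter i g y) = iter i g (E b y).
  have [Gi _ _] := group_inv G1.
  have /commutesP d1 := commutes_iter i (commutes_inv fK1 Kf1 c1).
  have /commutesP d2 := commutes_iter i (commutes_inv fK2 Kf2 c2).
  by rewrite /E; case: b => [[] []] /=; rewrite ?d1 ?d2.
have [z cz] := neq_id c_neq.
have /fin_all_exists[b hb] : forall i : 'I_5, exists b, U (E b (iter i g z)).
  move=> i; apply: cS; have /commutesP -> := commutes_iter i c_g.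
  by move/(injective_iter (group_inj Gg)).
suff bi : injective b by have := leq_card b bi; rewrite card_prod card_bool card_ord.
suff lt i j : b i = b j -> i < j -> False.
  by move=> i j bij; apply: val_inj; case: (ltngtP i j) => // ij;
    [case: (lt i j)|case: (lt j i)].
move=> bij ij; have : 0 < j - i <= 4.
  by rewrite subn_gt0 ij leq_subLR (leq_trans (_ : j <= 4)) ?leq_addl // -ltnS ltn_ord.
move/Ug => /(_ _ (hb i)); rewrite -Eg -iterD subnK ?(ltnW ij) // bij.
by rewrite hb.
Qed.

(** If [k] moves a point off the closure of the support of [f], it moves some cylinder [w], on which
    [f] is trivial, off itself; an element [g] supported in [w] with nontrivial 12th power is then
    disjoint from [f], but [g^12] does not commute with [k]. Conversely, the support of [g^12] is
    open and misses that of [f], hence misses its closure and the support of [k]. *)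
Lemma alg_supp_leP k f : G k -> G f -> alg_supp_le G k f <-> supp_le k f.
Proof.
move=> Gk Gf; split=> [kf x kx N|kf g Gg fg].
  apply: contrapT => /forallNP no.
  have [n1 m1] := move_off (group_continuous Gk) kx.
  set n := maxn N n1; set w := mkseq x n.
  have Uk y : cyl w y -> ~~ cyl w (k y).
    move=> /agree_cyl xy; apply/negP => /agree_cyl; apply: m1 xy; exact: leq_maxr.
  have Uf y : cyl w y -> f y = y.
    move=> /agree_cyl xy; apply: contrapT => fy; apply: (no y); split=> //.
    by apply: agree_le xy; exact: leq_maxl.
  have [p1 [p2 [[V1 V2] _ [S1 S2] [z hz]]]] := local_swaps hX w.
  set g := p2 \o p1 in hz; have gS y : ~~ cyl w y -> g y = y.
    by move=> wy; rewrite /g /= S1 ?S2.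
  have gS12 y : ~~ cyl w y -> iter 12 g y = y.
    by move=> /gS wy; exact: (@iter_fixed _ _ y 1 12).
  have Gg : G g by apply: group_comp; exact: hV.
  have /commutesP/(_ z) : commutes k (iter 12 g).
    apply: kf => //; apply: alg_disjoint_of_disjoint => // y.
    by case wy: (cyl w y); [left; exact: Uf | right; apply: gS; rewrite wy].
  have wz : cyl w z by apply: contraT => /gS12.
  by rewrite (gS12 (k z)) ?Uk // => /(group_inj Gk).
apply: commutes_disjoint; try exact: group_inj.
  exact: injective_iter (group_inj Gg).
move=> x; apply: contrapT => /not_orP[kx gx].
have [n hn] := move_off (continuous_iter 12 (group_continuous Gg)) gx.
have [y [xy fy]] := kf x kx n.
apply/fy/(disjoint_of_alg_disjoint Gf Gg fg) => gy.
by apply: (hn n (leqnn n) y xy); rewrite gy.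
Qed.

(** * Regular open supports and proper containment *)

Lemma supp_open f x : G f -> f x <> x -> exists n, forall y, agree n x y -> f y <> y.
Proof.
move=> Gf fx; have [n hn] := move_off (group_continuous Gf) fx.
by exists n => y xy fy; apply: (hn n (leqnn n) y xy); rewrite fy.
Qed.

Lemma supp_subset_cl f x : f x <> x -> supp_cl f x.
Proof. by move=> fx n; exists x. Qed.

Lemma supp_subset_int f x : G f -> f x <> x -> supp_int f x.
Proof.
by move=> Gf /(supp_open Gf)[n hn]; exists n => y /hn; exact: supp_subset_cl.
Qed.

Lemma supp_int_subset_cl f x : supp_int f x -> supp_cl f x.
Proof. by case=> n; apply. Qed.

Lemma supp_cl_small t x n y : (forall z, t z <> z -> agree n x z) -> supp_cl t y -> agree n x y.
Proof.
move=> ts /(_ n)[z [yz /ts xz]]; exact: agree_trans xz (agree_sym yz).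
Qed.

Lemma exists_neq (a : X) : exists b, a != b.
Proof.
have [c [d cd]] := two_letters hX.
by have [ac|] := eqVneq a c; [exists d; rewrite ac|exists c].
Qed.

Lemma small_swap x n : exists t, [/\ in_V t, t x <> x & forall y, t y <> y -> agree n x y].
Proof.
have [b xb] := exists_neq (x n).
(* The two words differ only in the last letter, so both cylinders lie in the cylinder of length [n]
   around [x]. *)
set u := mkseq x n.+1; set v := rcons (mkseq x n) b.
have uv : incomp u v by rewrite /u mkseqS; exact: incomp_rcons.
have cu : cyl u x by apply/agree_cyl.
exists (sw u v); split; first exact: sw_in_V.
  rewrite -{1}(prepend_sdrop cu) sw_l => h.
  by have := cyl_prepend v (sdrop (size u) x); rewrite h (incomp_cyl uv cu).
move=> y /sw_supp[/agree_cyl|]; first exact: agree_le.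
by rewrite cyl_rcons => /andP[/agree_cyl].
Qed.

(* When [f' <> id], this holds iff the closure of [supp f] is a proper subset of
   the interior of the closure of [supp f']. *)
Definition way_below f f' :=
  forall r, G r -> r <> id -> supp_le r f' ->
    exists g, [/\ G g, supp_le g f' & supp_le (g \o f \o cinv g) r].

(** Take [r] supported near a point [p] moved by [f'] and away from [x]. If [x] were outside
    [supp_int f'], the shrinking element [g] would fix [x], so [x] would still be in the closure of
    the support of the conjugate of [f], which lies near [p]. *)
Lemma way_below_cl f f' x : G f' -> f' <> id -> way_below f f' ->
  supp_cl f x -> supp_int f' x.
Proof.
move=> Gf' /neq_id[p hp] wb fx; apply: contrapT => nx.
have [n hn] := supp_open Gf' hp.
have px : p <> x by move=> e; apply/nx/supp_subset_int; rewrite -?e.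
have [N [nN npx]] := agree_neq n px.
have [r [Vr rp rs]] := small_swap p N; have Gr := hV Vr.
have [||g [Gg gs gr]] := wb r Gr.
- by move=> e; apply: rp; rewrite e.
- by move=> y /rs py; apply: supp_subset_cl; apply: hn; exact: agree_le py.
have [Gg' gK Kg] := group_inv Gg.
have gx : g x = x.
  apply: contrapT => gx; apply: nx; have [m hm] := supp_open Gg gx.
  by exists m => y /hm /gs.
have [m hm] := group_continuous Gg x N.
have [y [xy fy]] := fx m.
have := hm y xy; rewrite gx => xgy.
apply/npx/agree_sym/(agree_trans xgy)/agree_sym/(supp_cl_small rs)/gr.
by rewrite /= gK => /(group_inj Gg).
Qed.

Lemma way_below_small f' x : G f' -> supp_int f' x ->
  exists n, forall t, (forall y, t y <> y -> agree n x y) -> way_below t f'.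
Proof.
(* The extra letter leaves room for a sibling [v] of [u] inside the neighbourhood of length [N],
   needed when [p] itself lies in [u]. *)
move=> Gf' [N hN]; exists N.+1 => t ts r Gr /neq_id[p rp] rf'.
have [n1 hn1] := supp_open Gr rp.
have [b xb] := exists_neq (x N).
set u := mkseq x N.+1; set v := rcons (mkseq x N) b.
set w := mkseq p (maxn N.+1 n1).
have uv : incomp u v by rewrite /u mkseqS; exact: incomp_rcons.
have uS y : cyl u y -> agree N x y by move=> /agree_cyl; exact: agree_le.
have vS y : cyl v y -> agree N x y by rewrite cyl_rcons => /andP[/agree_cyl].
have wr y : cyl w y -> r y <> y.
  by move=> /agree_cyl h; apply: hn1; apply: agree_le h; exact: leq_maxr.
suff [g [Gg gs gu]] : exists g, [/\ G g,
    forall y, g y <> y -> [\/ cyl u y, cyl v y | cyl w y] &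
    forall y, cyl u y -> cyl w (g y)].
  have [_ gK Kg] := group_inv Gg; exists g; split=> //.
    by move=> y /gs[/uS/hN|/vS/hN|/wr/rf'].
  move=> y gy; apply: supp_subset_cl; apply: wr; rewrite -(Kg y); apply: gu.
  by apply/agree_cyl/ts => ty; apply: gy; rewrite /= ty Kg.
have sz : size u <= size w by rewrite !size_mkseq leq_maxl.
have cp : cyl w p by apply/agree_cyl.
(* When [p] is outside [u], a single swap carries [u] onto the cylinder [w] around [p]. *)
case up: (cyl u p); last first.
  have uw : incomp u w.
    have h : ~~ prefix u w by apply/negP => /cyl_prefix/(_ cp); rewrite up.
    rewrite /incomp h; apply: contra h => h.
    by move: (h); rewrite prefixE take_oversize // => /eqP ->; exact: prefix_refl.
  exists (sw u w); split; first exact/hV/sw_in_V.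
    by move=> y /sw_supp[]; [constructor 1|constructor 3].
  by move=> y uy; rewrite -(prepend_sdrop uy) sw_l cyl_prepend.
have vw : incomp v w.
  have /prefixP[s ->] := cyl2_prefix sz up cp.
  by rewrite incompC; exact: incomp_catl.
(* Here [w] extends [u], so the two cannot be swapped directly; [u] is sent to [v] first, then to
   [w]. *)
exists (sw v w \o sw u v); split.
- by apply: group_comp; exact/hV/sw_in_V.
- move=> y; have [e|] := pselect (sw u v y = y).
    by rewrite /= e => /sw_supp[]; [constructor 2|constructor 3].
  by move=> /sw_supp[]; [constructor 1|constructor 2].
- by move=> y uy; rewrite /= -(prepend_sdrop uy) !sw_l cyl_prepend.
Qed.

(** A swap moving [x] and supported in a cylinder that excludes [y] distinguishes the two points. *)
Lemma supp_int_separates x y : (forall f, G f -> supp_int f x -> supp_int f y) -> y = x.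
Proof.
move=> h; apply: contrapT => /nesym/(agree_neq 0)[n [_ nxy]].
have [t [Vt tx ts]] := small_swap x n; have Gt := hV Vt.
by apply/nxy/(supp_cl_small ts)/supp_int_subset_cl/h/supp_subset_int.
Qed.

Lemma supp_int_conj f g x : G f -> G g ->
  supp_int f (g x) <-> supp_int (cinv g \o f \o g) x.
Proof.
have conj f1 g1 g2 x1 : G g1 -> G g2 -> cancel g1 g2 -> cancel g2 g1 ->
    supp_int f1 (g1 x1) -> supp_int (g2 \o f1 \o g1) x1.
  move=> G1 G2 g12 g21 [n hn]; have [m hm] := group_continuous G1 x1 n.
  exists m => y /hm /hn fy k.
  have [q hq] := group_continuous G2 (g1 y) k.
  have [z [yz fz]] := fy q; exists (g2 z); split.
    by have := hq z yz; rewrite g12.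
  by rewrite /= g21 => /(can_inj g21).
move=> Gf Gg; have [Gg' gK Kg] := group_inv Gg; split; first exact: conj.
rewrite -{1}(gK x) => /(conj _ _ _ _ Gg' Gg Kg gK).
by congr supp_int; apply: funext => y; rewrite /= !Kg.
Qed.

End Reconstruction.

(** * Transport along an abstract isomorphism *)

Lemma group_iso_inverse (X1 X2 : Type)
    (G1 : (cantor X1 -> cantor X1) -> Prop) (G2 : (cantor X2 -> cantor X2) -> Prop) phi :
  homeo_group G1 -> group_iso G1 G2 phi ->
  exists psi, [/\ group_iso G2 G1 psi, forall f, G1 f -> psi (phi f) = f &
    forall k, G2 k -> phi (psi k) = k].
Proof.
move=> [_ _ Gc _] [phiG phiM phiI phiS].
have /choice[psi psiP] : forall k, exists f, G2 k -> G1 f /\ phi f = k.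
  move=> k; have [/phiS[f Gf fk]|nk] := pselect (G2 k); first by exists f.
  (* An arbitrary value outside [G2]. *)
  by exists id.
have psiG k : G2 k -> G1 (psi k) by case/psiP.
have psiK k : G2 k -> phi (psi k) = k by case/psiP.
have phiK f : G1 f -> psi (phi f) = f.
  by move=> Gf; have Gp := phiG _ Gf; apply: phiI; rewrite ?psiK //; exact: psiG.
exists psi; split=> //; split=> //.
- move=> g h Gg Gh; rewrite -{1}(psiK g) // -{1}(psiK h) // -phiM ?phiK //; do ?exact: psiG.
  by apply: Gc; exact: psiG.
- by move=> g h Gg Gh e; rewrite -(psiK g) // e psiK.
- by move=> f Gf; exists (phi f); [exact: phiG | exact: phiK].
Qed.

Section Isomorphism.
Variables (X1 X2 : finType).
Variables (G1 : (cantor X1 -> cantor X1) -> Prop) (G2 : (cantor X2 -> cantor X2) -> Prop).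
Variable phi : (cantor X1 -> cantor X1) -> (cantor X2 -> cantor X2).
Hypotheses (hG1 : homeo_group G1) (hG2 : homeo_group G2) (hphi : group_iso G1 G2 phi).
Implicit Types (f g k : cantor X1 -> cantor X1).

Lemma iso_in f : G1 f -> G2 (phi f).
Proof. by case: hphi => h _ _ _; exact: h. Qed.

Lemma iso_comp f g : G1 f -> G1 g -> phi (f \o g) = phi f \o phi g.
Proof. by case: hphi => _ h _ _; exact: h. Qed.

Lemma iso_inj f g : G1 f -> G1 g -> phi f = phi g -> f = g.
Proof. by case: hphi => _ _ h _; exact: h. Qed.

Lemma iso_id : phi id = id.
Proof.
have Gi : G1 id by case: hG1.
apply: funext => x; apply: (group_inj hG2 (iso_in Gi)).
by have := iso_comp Gi Gi => /(congr1 (@^~ x)) /= <-.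
Qed.

Lemma iso_inv g : G1 g -> phi (cinv g) = cinv (phi g).
Proof.
move=> Gg; have [Gg' gK Kg] := group_inv hG1 Gg; apply/esym/cinv_eq => x.
  have : phi (cinv g \o g) = id by rewrite -iso_id; congr phi; apply: funext.
  by rewrite iso_comp // => /(congr1 (@^~ x)).
have : phi (g \o cinv g) = id by rewrite -iso_id; congr phi; apply: funext.
by rewrite iso_comp // => /(congr1 (@^~ x)).
Qed.

Lemma iso_commutes f g : G1 f -> G1 g -> commutes f g -> commutes (phi f) (phi g).
Proof. by move=> Gf Gg c; rewrite /commutes -!iso_comp // c. Qed.

Lemma iso_commutator f g : G1 f -> G1 g ->
  phi (commutator f g) = commutator (phi f) (phi g).
Proof.
move=> Gf Gg; have [Gf' _ _] := group_inv hG1 Gf; have [Gg' _ _] := group_inv hG1 Gg.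
have Gfg := group_comp hG1 Gf Gg; have Gfgf := group_comp hG1 Gfg Gf'.
by rewrite /commutator (iso_comp Gfgf) // (iso_comp Gfg) // iso_comp // !iso_inv.
Qed.

Lemma iso_iter g n : G1 g -> phi (iter n g) = iter n (phi g).
Proof.
move=> Gg; elim: n => [|n IH]; first exact: iso_id.
by rewrite (_ : iter n.+1 g = g \o iter n g) // iso_comp ?IH //; exact: group_iter.
Qed.

Lemma iso_alg_disjoint f g : G1 f -> G1 g ->
  alg_disjoint G1 f g -> alg_disjoint G2 (phi f) (phi g).
Proof.
case: (hphi) => _ _ _ phiS Gf Gg fg _ /phiS[h Gh <-] nc.
have [|f1 [f2 [F1 F2 c1 c2 [nid cg]]]] := fg h Gh.
  by move=> c; apply: nc; exact: iso_commutes.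
exists (phi f1), (phi f2); split; do ?[exact: iso_in | exact: iso_commutes].
have Gc := group_comm hG1 F2 Gh; have Gcc := group_comm hG1 F1 Gc.
rewrite -!iso_commutator //; split; last exact: iso_commutes.
rewrite -iso_id => /iso_inj e; apply/nid/e => //.
by case: hG1.
Qed.

End Isomorphism.

Section Transport.
Variables (X1 X2 : finType).
Variables (G1 : (cantor X1 -> cantor X1) -> Prop) (G2 : (cantor X2 -> cantor X2) -> Prop).
Variable phi : (cantor X1 -> cantor X1) -> (cantor X2 -> cantor X2).
Hypotheses (hX1 : 1 < #|X1|) (hX2 : 1 < #|X2|).
Hypotheses (hG1 : homeo_group G1) (hG2 : homeo_group G2).
Hypotheses (hV1 : forall g, in_V g -> G1 g) (hV2 : forall g, in_V g -> G2 g).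
Hypothesis hphi : group_iso G1 G2 phi.
Implicit Types (f g k : cantor X1 -> cantor X1).

(** By [alg_supp_leP] on both sides the relation is a statement about the abstract group; the test
    element [g] of [G2] is pulled back along the inverse isomorphism. *)
Lemma iso_supp_le k f : G1 k -> G1 f -> supp_le k f -> supp_le (phi k) (phi f).
Proof.
move=> Gk Gf /(alg_supp_leP hX1 hG1 hV1 Gk Gf) kf.
have [psi [hpsi phiK psiK]] := group_iso_inverse hG1 hphi.
apply/(alg_supp_leP hX2 hG2 hV2 (iso_in hphi Gk) (iso_in hphi Gf)) => g Gg fg.
have Gg1 := iso_in hpsi Gg.
rewrite -(psiK g) // -(iso_iter hG1 hG2 hphi) //; apply: (iso_commutes hphi) => //.
  exact: group_iter.
apply: kf => //; rewrite -(phiK f) //.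
exact: (iso_alg_disjoint hG2 hG1 hpsi (iso_in hphi Gf)).
Qed.

Lemma iso_neq_id f : G1 f -> f <> id -> phi f <> id.
Proof.
move=> Gf nf; rewrite -(iso_id hG1 hG2 hphi) => /(iso_inj hphi Gf) e; apply/nf/e.
by case: hG1.
Qed.

End Transport.

(** * Points of the second space from points of the first *)

Section Points.
Variables (X1 X2 : finType).
Variables (G1 : (cantor X1 -> cantor X1) -> Prop) (G2 : (cantor X2 -> cantor X2) -> Prop).
Variable phi : (cantor X1 -> cantor X1) -> (cantor X2 -> cantor X2).
Hypotheses (hX1 : 1 < #|X1|) (hX2 : 1 < #|X2|).
Hypotheses (hG1 : homeo_group G1) (hG2 : homeo_group G2).
Hypotheses (hV1 : forall g, in_V g -> G1 g) (hV2 : forall g, in_V g -> G2 g).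
Hypothesis hphi : group_iso G1 G2 phi.
Implicit Types (f g k : cantor X1 -> cantor X1).

Lemma iso_way_below f f' : G1 f -> G1 f' ->
  way_below G1 f f' -> way_below G2 (phi f) (phi f').
Proof.
move=> Gf Gf' wb r Gr nr rf'.
have [psi [hpsi phiK psiK]] := group_iso_inverse hG1 hphi.
have Gr1 := iso_in hpsi Gr.
have [||g [Gg gs gr]] := wb (psi r) Gr1.
- exact: (iso_neq_id hG2 hG1 hpsi).
- rewrite -(phiK f') //.
  exact: (iso_supp_le hX2 hX1 hG2 hG1 hV2 hV1 hpsi Gr (iso_in hphi Gf')).
have [Gg' _ _] := group_inv hG1 Gg; have Ggf := group_comp hG1 Gg Gf.
exists (phi g); split; first exact: (iso_in hphi).
  exact: (iso_supp_le hX1 hX2 hG1 hG2 hV1 hV2 hphi).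
rewrite -(psiK r) // -(iso_inv hG1 hG2 hphi) // -!(iso_comp hphi) //.
apply: (iso_supp_le hX1 hX2 hG1 hG2 hV1 hV2 hphi) => //.
exact: (group_comp hG1).
Qed.

(* Compactness: the closed sets [supp_cl (phi t)], for [t] supported near [x],
   have the finite intersection property. *)
Lemma iso_point x : exists y, forall f, G1 f -> supp_int f x -> supp_int (phi f) y.
Proof.
have /choice[t tP] := small_swap hX1 x.
have Gt n : G1 (t n) by apply: hV1; case: (tP n).
have tx n : t n x <> x by case: (tP n).
have ts n y : t n y <> y -> agree n x y by case: (tP n) => _ _; exact.
have tle n : exists m, forall p, m <= p -> supp_le (t p) (t n).
  have [m hm] := supp_open hG1 (Gt n) (tx n).
  exists m => p mp y /ts xy; apply: supp_subset_cl; apply: hm; exact: agree_le xy.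
(* An infinite branch of good words is built as in König's lemma: the cylinder of a good word meets
   the support of every [phi (t n)]. *)
pose good w := forall n, exists2 z, cyl w z & phi (t n) z <> z.
have good0 : good [::].
  move=> n; have : phi (t n) <> id.
    by apply: (iso_neq_id hG1 hG2 hphi) => // e; apply: (tx n); rewrite e.
  by case/neq_id=> z hz; exists z.
have goodS w : exists a, good w -> good (rcons w a).
  have [gw|] := pselect (good w); last first.
    by have [a _] := two_letters hX2; exists a.
  apply: contrapT => /forallNP ng.
  have /fin_all_exists[n hn] : forall a, exists n, forall z, cyl (rcons w a) z ->
      phi (t n) z = z.
    move=> a; apply: contrapT => /forallNP h; apply: (ng a) => _ n.
    apply: contrapT => /forall2NP h2; apply: (h n) => z wz.
    by apply: contrapT => nz; case: (h2 z).
  have /fin_all_exists[m hm] a := tle (n a).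
  (* Were every extension by a letter [a] bad, with witness [n a], this one index would beat all of
     them: a point [z] of [w] moved by its image lies in the closure of the support of
     [phi (t (n a))] for the next letter [a] of [z], contradicting the choice of [n a]. *)
  have [z wz tz] := gw (\max_a m a).
  have le : supp_le (t (\max_a m a)) (t (n (z (size w)))).
    by apply: hm; exact: leq_bigmax.
  have [y [zy]] := iso_supp_le hX1 hX2 hG1 hG2 hV1 hV2 hphi (Gt _) (Gt _) le tz (size w).+1.
  apply; apply: hn; rewrite cyl_rcons (cyl_agree wz) ?zy ?eqxx //.
  exact: agree_le zy.
have [next nextP] := choice goodS.
pose pre n := iter n (fun w => rcons w (next w)) [::].
have pre_good n : good (pre n) by elim: n => //= n IH; exact: nextP.
pose y n := next (pre n).
have preE n : pre n = mkseq y n by elim: n => //= n IH; rewrite mkseqS -IH.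
have ycl n : supp_cl (phi (t n)) y.
  move=> m; have [z cz tz] := pre_good m n; exists z; split=> //.
  by apply/agree_cyl; rewrite -preE.
exists y => f Gf fx.
(* For large [n] the element [t n] is way below [f]; transporting this turns membership in a closure
   into membership in the open set [supp_int (phi f)]. *)
have [n hn] := way_below_small hX1 hG1 hV1 Gf fx.
have wb := hn (t n) (ts n).
have nf : f <> id.
  by have [z [_ fz]] := supp_int_subset_cl fx 0 => e; apply: fz; rewrite e.
apply: (way_below_cl hX2 hG2 hV2 (iso_in hphi Gf) (iso_neq_id hG1 hG2 hphi Gf nf)) (ycl n).
exact: iso_way_below.
Qed.

End Points.

(** * The induced map on points and its properties *)

Section PointMap.
Variables (X1 X2 : finType).
Variables (G1 : (cantor X1 -> cantor X1) -> Prop) (G2 : (cantor X2 -> cantor X2) -> Prop).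
Variable phi : (cantor X1 -> cantor X1) -> (cantor X2 -> cantor X2).
Hypotheses (hX1 : 1 < #|X1|) (hX2 : 1 < #|X2|).
Hypotheses (hG1 : homeo_group G1) (hG2 : homeo_group G2).
Hypotheses (hV1 : forall g, in_V g -> G1 g) (hV2 : forall g, in_V g -> G2 g).
Hypothesis hphi : group_iso G1 G2 phi.

(** Going to [y] by [phi] and back to [x'] by the inverse, [x'] lies in every [supp_int f] that
    contains [x]; separation gives [x' = x], which closes the circle of implications. *)
Lemma iso_point_iff x :
  exists y, forall f, G1 f -> supp_int f x <-> supp_int (phi f) y.
Proof.
have [psi [hpsi phiK psiK]] := group_iso_inverse hG1 hphi.
have [y xy] := iso_point hX1 hX2 hG1 hG2 hV1 hV2 hphi x.
have [x' yx'] := iso_point hX2 hX1 hG2 hG1 hV2 hV1 hpsi y.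
have e : x' = x.
  apply: (supp_int_separates hX1 hG1 hV1) => f Gf /(xy f Gf) /yx'; rewrite phiK //.
  by apply; exact: (iso_in hphi).
exists y => f Gf; split; first exact: xy.
by move=> /yx'; rewrite phiK // e; apply; exact: (iso_in hphi).
Qed.

(** Some [supp_int t] contains [F x] and lies in the given cylinder, and its preimage under [F] is
    [supp_int (psi t)], which is open. *)
Lemma point_map_continuous (F : cantor X1 -> cantor X2) :
  (forall x f, G1 f -> supp_int f x <-> supp_int (phi f) (F x)) -> continuous F.
Proof.
move=> FP x n; have [t [Vt tx ts]] := small_swap hX2 (F x) n.
have [psi [hpsi phiK psiK]] := group_iso_inverse hG1 hphi.
have Gt := hV2 Vt; have Gf := iso_in hpsi Gt.
have : supp_int (psi t) x by rewrite (FP _ _ Gf) psiK //; exact: (supp_subset_int hG2).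
case=> m hm; exists m => y xy; apply: (supp_cl_small ts); apply: supp_int_subset_cl.
rewrite -(psiK t) // -(FP _ _ Gf); exists m => z yz; apply: hm; exact: agree_trans yz.
Qed.

(** Conjugating [f] by [g] moves [supp_int f] by the inverse of [g], and [phi] respects conjugation,
    so [F (g x)] and [phi g (F x)] lie in the same sets [supp_int (phi f)]; these separate
    points. *)
Lemma point_map_equivariant (F : cantor X1 -> cantor X2) :
  (forall x f, G1 f -> supp_int f x <-> supp_int (phi f) (F x)) ->
  forall g x, G1 g -> F (g x) = phi g (F x).
Proof.
move=> FP g x Gg; apply: (supp_int_separates hX2 hG2 hV2) => k.
case: (hphi) => _ _ _ phiS /phiS[f Gf <-].
have [Gg' _ _] := group_inv hG1 Gg.
have Gc := group_comp hG1 (group_comp hG1 Gg' Gf) Gg.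
rewrite (supp_int_conj hG2 _ (iso_in hphi Gf) (iso_in hphi Gg)) -(iso_inv hG1 hG2 hphi) //.
rewrite -!(iso_comp hphi) //; last exact: (group_comp hG1).
by rewrite -(FP _ _ Gc) -(supp_int_conj hG1) // (FP _ _ Gf).
Qed.

End PointMap.

Theorem theorem7p4 (X1 X2 : finType) (hX1 : 1 < #|X1|) (hX2 : 1 < #|X2|)
    (G1 : (cantor X1 -> cantor X1) -> Prop) (G2 : (cantor X2 -> cantor X2) -> Prop)
    (hG1 : homeo_group G1) (hG2 : homeo_group G2)
    (hV1 : forall g, in_V g -> G1 g) (hV2 : forall g, in_V g -> G2 g)
    (phi : (cantor X1 -> cantor X1) -> (cantor X2 -> cantor X2))
    (hphi : group_iso G1 G2 phi) :
  exists (F : cantor X1 -> cantor X2) (Finv : cantor X2 -> cantor X1),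
    homeo_pair F Finv /\ forall g, G1 g -> phi g = F \o g \o Finv.
Proof.
have [psi [hpsi phiK psiK]] := group_iso_inverse hG1 hphi.
have [F FP] := choice (iso_point_iff hX1 hX2 hG1 hG2 hV1 hV2 hphi).
have [Finv FinvP] := choice (iso_point_iff hX2 hX1 hG2 hG1 hV2 hV1 hpsi).
(* [x] and [Finv (F x)] lie in the same sets [supp_int f], hence coincide; likewise on the other
   side. *)
have FK : cancel F Finv.
  move=> x; apply: (supp_int_separates hX1 hG1 hV1) => f Gf.
  by rewrite (FP _ _ Gf) (FinvP _ _ (iso_in hphi Gf)) phiK.
have KF : cancel Finv F.
  move=> y; apply: (supp_int_separates hX2 hG2 hV2) => k Gk.
  by rewrite (FinvP _ _ Gk) (FP _ _ (iso_in hpsi Gk)) psiK.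
exists F, Finv; split.
  split=> //; first exact: (point_map_continuous hX2 hG1 hG2 hV2 hphi FP).
  exact: (point_map_continuous hX1 hG2 hG1 hV1 hpsi FinvP).
move=> g Gg; apply: funext => y /=.
by rewrite (point_map_equivariant hX2 hG1 hG2 hV2 hphi FP) // KF.
Qed.
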